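(* Let $R$ be a unital ring, $\mathrm{L}$ a length function on left $R$-modules with $\mathrm{L}(R)<\infty$, $\Gamma$ a sofic group, $\Sigma=\{\sigma_i:\Gamma\to \mathrm{Sym}(d_i)\}_{i\in J}$ a sofic approximation net for $\Gamma$, and $\omega$ a free ultrafilter on $J$. Let $f\in M_{m, n}(R\Gamma)$ for some $m, n\in \mathbb{N}$. Set $\mathcal{M}_1=(R\Gamma)^{1\times m}f$ and $\mathcal{M}_2=(R\Gamma)^{1\times n}$. Then $$\mathrm{mL}_{\Sigma, \omega}(\mathcal{M}_1|\mathcal{M}_2)=\lim_{i\to \omega}\frac{\mathrm{L}(\mathrm{im}\, \bar{\sigma}_{i, f})}{d_i}.$$
   Context: All modules are left modules. Write $[d]=\{1,\dots,d\}$, $\mathrm{Sym}(d)$ for the permutation group of $[d]$, $\mathcal{F}(\Gamma)$ for the set of all finite subsets of $\Gamma$, and $\mathscr{F}(\mathscr{M})$ for the set of all finitely generated $R$-submodules of an $R$-module $\mathscr{M}$. Elements of the group ring $R\Gamma$ are written $\sum_{s\in\Gamma}f_ss$ (finitely supported). The maps $\bar\sigma_f$: for a map $\sigma:\Gamma\to\mathrm{Sym}(d)$, write $sv=\sigma_s(v)$. For $g\in R\Gamma$ define the $R$-module homomorphism $\bar\sigma_g:R^d\to R^d$ by $(\bar\sigma_g(w))_v=\sum_{s\in\Gamma}w_{sv}g_s$ for $v\in[d]$. For $f=(f_{k,j})\in M_{m,n}(R\Gamma)$ define $\bar\sigma_f:(R^d)^{1\times m}\to(R^d)^{1\times n}$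 by $(\bar\sigma_f(w))_j=\sum_{k=1}^m\bar\sigma_{f_{k,j}}(w_k)$ for $1\le j\le n$. $\bar\sigma_{i,f}$ is this map for $\sigma=\sigma_i$. Length function: an assignment $\mathscr{M}\mapsto \mathrm{L}(\mathscr{M})\in \mathbb{R}_{\ge 0}\cup\{+\infty\}$ on $R$-modules such that $\mathrm{L}(0)=0$; $\mathrm{L}(\mathscr{M}_2)=\mathrm{L}(\mathscr{M}_1)+\mathrm{L}(\mathscr{M}_3)$ for every short exact sequence $0\to \mathscr{M}_1\to\mathscr{M}_2\to\mathscr{M}_3\to 0$; and $\mathrm{L}(\mathscr{M})=\sup_{\mathscr{N}\in \mathscr{F}(\mathscr{M})}\mathrm{L}(\mathscr{N})$. A module is locally $\mathrm{L}$-finite if each of its finitely generated $R$-submodules has finite $\mathrm{L}$-length. Sofic approximation net for a discrete group $\Gamma$: a net of maps $\sigma_i:\Gamma\to\mathrm{Sym}(d_i)$, indexed by a directed set $J$, such that $\lim_i |\{v\in[d_i]:\sigma_{i,s}\sigma_{i,t}(v)=\sigma_{i,st}(v)\}|/d_i=1$ for all $s,t\in \Gamma$; $\lim_i|\{v\in[d_i]:\sigma_{i,s}(v)\ne\sigma_{i,t}(v)\}|/d_i=1$ for all distinct $s,t\in\Gamma$; and $\lim_i d_i=+\infty$. $\Gamma$ is sofic if such a net exists. An ultrafilter $\omega$ on $J$ is free if $\{i\in J:i\ge j\}\in\omega$ for every $j\in J$. Mean length: let $\mathcal{M}_1\subseteq\mathcal{M}_2$ be $R\Gamma$-modules with $\mathcal{M}_1$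 locally $\mathrm{L}$-finite, $\mathscr{A}\in\mathscr{F}(\mathcal{M}_1)$, $\mathscr{B}\in\mathscr{F}(\mathcal{M}_2)$, $F\in\mathcal{F}(\Gamma)$, $\sigma:\Gamma\to\mathrm{Sym}(d)$. For $x\in\mathcal{M}_2$, $v\in[d]$, let $\delta_vx\in\mathcal{M}_2^d$ take value $x$ at $v$ and $0$ elsewhere. Let $\mathscr{M}(\mathscr{B},F,\sigma)$ be the $R$-submodule of $\mathcal{M}_2^d$ generated by $\delta_vb-\delta_{sv}sb$ for $v\in[d]$, $b\in\mathscr{B}$, $s\in F$, and let $\mathscr{M}(\mathscr{A},\mathscr{B},F,\sigma)$ be the image of $\mathscr{A}^d$ in $\mathcal{M}_2^d/\mathscr{M}(\mathscr{B},F,\sigma)$. Define $$\mathrm{mL}_{\Sigma,\omega}(\mathcal{M}_1|\mathcal{M}_2)=\sup_{\mathscr{A}\in\mathscr{F}(\mathcal{M}_1)}\ \inf_{\mathscr{B}\in\mathscr{F}(\mathcal{M}_2)}\ \inf_{F\in\mathcal{F}(\Gamma)}\ \lim_{i\to\omega}\frac{\mathrm{L}(\mathscr{M}(\mathscr{A},\mathscr{B},F,\sigma_i))}{d_i}.$$ *)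

(* Defs.v *)
From HB Require Import structures.
From mathcomp Require Import all_boot all_order all_algebra.
From mathcomp Require Import perm generic_quotient ring_quotient finmap.
From mathcomp Require Import all_classical all_reals.
From mathcomp Require Import ereal topology normedtype sequences.
Set Implicit Arguments.
Unset Strict Implicit.
Unset Printing Implicit Defensive.
Import Order.TTheory GRing.Theory Num.Theory.
Import numFieldNormedType.Exports.
Local Open Scope classical_set_scope.
Local Open Scope ring_scope.

Section Submodules.
Variables (R : pzRingType) (M : lmodType R).

(* Submodules are the library's [submodClosed M]; [submod N] is the submodule
   [N] seen as a module in its own right. *)
Definition submod (N : submodClosed M) : Type := {x : M | x \in N}.
HB.instance Definition _ (N : submodClosed M) := SubChoice.on (submod N).
HB.instance Definition _ (N : submodClosed M) :=
  [SubChoice_isSubLmodule of submod N by <:].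

Definition span_mod (X : set M) : {pred M} :=
  fun x => `[< forall N : submodClosed M, (forall y, X y -> y \in N) -> x \in N >].

Fact span_mod_closed X : subsemimod_closed (span_mod X).
Proof.
split; first split.
- by apply/asboolP => N _; exact: rpred0.
- move=> x y /asboolP Sx /asboolP Sy; apply/asboolP => N XN.
  by rewrite rpredD ?Sx ?Sy.
- move=> a x /asboolP Sx; apply/asboolP => N XN.
  by rewrite rpredZ ?Sx.
Qed.

HB.instance Definition _ X :=
  GRing.isSubmodClosed.Build R M (span_mod X) (span_mod_closed X).

(* [fin_gen N]: [N] is the submodule generated by a finite list; the zero
   submodule is included, as it is generated by the empty list. *)
Definition fin_gen (N : {pred M}) : Prop := exists s : seq M, N =i span_mod [set` s].

(* N^d inside M^d. *)
Definition submod_pow (N : {pred M}) (d : nat) : {pred {ffun 'I_d -> M}} :=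
  fun w => [forall v, w v \in N].

Fact submod_pow_closed d (N : submodClosed M) :
  subsemimod_closed (@submod_pow N d).
Proof.
split; first split.
- by apply/forallP => v; rewrite ffunE rpred0.
- move=> x y /forallP Nx /forallP Ny; apply/forallP => v.
  by rewrite ffunE rpredD.
- by move=> a x /forallP Nx; apply/forallP => v; rewrite ffunE rpredZ.
Qed.

HB.instance Definition _ d (N : submodClosed M) :=
  GRing.isSubmodClosed.Build R {ffun 'I_d -> M} (@submod_pow N d)
    (submod_pow_closed d N).

Fact submod_zmod_closed (N : submodClosed M) : zmod_closed [in N].
Proof.
split=> [|x y Nx Ny]; first exact: rpred0.
by rewrite -scaleN1r rpredD ?rpredZ.
Qed.

(* [submodClosed] does not inherit from [zmodClosed] in the library, hence this
   detour before using [Quotient.quot]. *)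
Definition submod_zmod_pred (N : submodClosed M) : {pred M} := [in N].
HB.instance Definition _ (N : submodClosed M) :=
  GRing.isZmodClosed.Build M (submod_zmod_pred N) (submod_zmod_closed N).

Definition quotmod (N : submodClosed M) : Type :=
  Quotient.quot (submod_zmod_pred N).
HB.instance Definition _ (N : submodClosed M) := GRing.Zmodule.on (quotmod N).

Section Quotient.
Local Open Scope quotient_scope.
Variable N : submodClosed M.

Definition quot_pi (x : M) : quotmod N := \pi_(Quotient.quot (submod_zmod_pred N)) x.

Fact quot_pi_eq x y : (quot_pi x == quot_pi y) = (x - y \in N).
Proof. by rewrite /quot_pi -Quotient.idealrBE. Qed.

Definition quot_scale (a : R) (q : quotmod N) : quotmod N :=
  quot_pi (a *: repr (q : Quotient.quot (submod_zmod_pred N))).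

Fact quot_piK (q : quotmod N) :
  quot_pi (repr (q : Quotient.quot (submod_zmod_pred N))) = q.
Proof. exact: reprK. Qed.

Fact quot_piD : {morph quot_pi : x y / x + y}.
Proof. by move=> x y; rewrite /quot_pi raddfD. Qed.

Fact quot_scale_pi a x : quot_scale a (quot_pi x) = quot_pi (a *: x).
Proof.
by apply/eqP; rewrite quot_pi_eq -scalerBr rpredZ// -quot_pi_eq quot_piK.
Qed.

Fact quot_scaleA a b q : quot_scale a (quot_scale b q) = quot_scale (a * b) q.
Proof. by rewrite -[q]quot_piK !quot_scale_pi scalerA. Qed.

Fact quot_scale1 : left_id 1 quot_scale.
Proof. by move=> q; rewrite -[q]quot_piK quot_scale_pi scale1r. Qed.

Fact quot_scaleDr : right_distributive quot_scale +%R.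
Proof.
move=> a p q; rewrite -[p]quot_piK -[q]quot_piK.
by rewrite -quot_piD !quot_scale_pi scalerDr quot_piD.
Qed.

Fact quot_scaleDl q : {morph quot_scale^~ q : a b / a + b}.
Proof.
by move=> a b; rewrite -[q]quot_piK !quot_scale_pi scalerDl quot_piD.
Qed.

HB.instance Definition _ := GRing.Zmodule_isLmodule.Build R (quotmod N)
  quot_scaleA quot_scale1 quot_scaleDr quot_scaleDl.

Fact quot_pi_is_linear : linear quot_pi.
Proof. by move=> a x y; rewrite quot_piD -quot_scale_pi. Qed.

HB.instance Definition _ := GRing.isLinear.Build R M (quotmod N) *:%R quot_pi
  quot_pi_is_linear.

End Quotient.

End Submodules.
Arguments submod_pow {R M} N d.

Section Images.
Variables (R : pzRingType) (M M' : lmodType R) (phi : {linear M -> M'}).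

Definition image_mod (N : {pred M}) : {pred M'} :=
  fun y => `[< exists2 x, x \in N & y = phi x >].

Fact image_mod_closed (N : submodClosed M) : subsemimod_closed (image_mod N).
Proof.
split; first split.
- by apply/asboolP; exists 0; rewrite ?rpred0 ?linear0.
- move=> _ _ /asboolP[x Nx ->] /asboolP[y Ny ->]; apply/asboolP.
  by exists (x + y); rewrite ?rpredD ?linearD.
- move=> a _ /asboolP[x Nx ->]; apply/asboolP.
  by exists (a *: x); rewrite ?rpredZ ?linearZ.
Qed.

HB.instance Definition _ (N : submodClosed M) :=
  GRing.isSubmodClosed.Build R M' (image_mod N) (image_mod_closed N).

Definition range_mod : {pred M'} := fun y => `[< range phi y >].

Fact range_mod_closed : subsemimod_closed range_mod.
Proof.
split; first split.
- by apply/asboolP; exists 0; rewrite ?linear0.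
- move=> _ _ /asboolP[x _ <-] /asboolP[y _ <-]; apply/asboolP.
  by exists (x + y); rewrite ?linearD.
- move=> a _ /asboolP[x _ <-]; apply/asboolP.
  by exists (a *: x); rewrite ?linearZ.
Qed.

HB.instance Definition _ :=
  GRing.isSubmodClosed.Build R M' range_mod range_mod_closed.

End Images.

(* L(0) = 0 is stated for every module with a single element. *)
Record length_function (K : realType) (R : pzRingType)
    (L : lmodType R -> \bar K) : Prop := LengthFunction {
  length_ge0 : forall M : lmodType R, (0 <= L M)%E;
  length_zero : forall M : lmodType R, (forall x : M, x = 0) -> L M = 0%E;
  length_exact : forall (M1 M2 M3 : lmodType R)
      (i : {linear M1 -> M2}) (p : {linear M2 -> M3}),
    injective i -> range i = [set x | p x = 0] -> range p = [set: M3] ->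
    L M2 = (L M1 + L M3)%E;
  length_sup : forall M : lmodType R,
    L M = ereal_sup [set L (submod N) | N in [set N : submodClosed M | fin_gen N]]
}.

Section GroupRing.
Variables (R : pzRingType) (G : groupType).
Local Open Scope fset_scope.
Local Open Scope ring_scope.

(* The group ring R[G]: [f s] is the coefficient of s. R and G commute in R[G],
   so (f g)_u = \sum_s f_s g_(s^-1 u). *)
Definition grpring : Type := {fsfun G -> R with 0}.
HB.instance Definition _ := Choice.on grpring.
Implicit Types f g h : grpring.

Definition gr_mono (a : R) (s : G) : grpring := [fsfun u in [fset s] => a].
Definition gr_add f g : grpring :=
  [fsfun s in finsupp f `|` finsupp g => f s + g s].
Definition gr_opp f : grpring := [fsfun s in finsupp f => - f s].
Definition gr_mul f g : grpring :=
  [fsfun u in [fset (s * t)%g | s in finsupp f, t in finsupp g] =>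
     \sum_(s <- finsupp f) f s * g (s^-1 * u)%g].

Fact gr_monoE a s u : gr_mono a s u = if u == s then a else 0.
Proof. by rewrite fsfunE inE. Qed.

Fact gr_addE f g s : gr_add f g s = f s + g s.
Proof.
by rewrite fsfunE inE; do 2 case: finsuppP => //= _; rewrite addr0.
Qed.

Fact gr_oppE f s : gr_opp f s = - f s.
Proof. by rewrite fsfunE; case: finsuppP => //=; rewrite oppr0. Qed.

Fact gr_mulE f g u : gr_mul f g u = \sum_(s <- finsupp f) f s * g (s^-1 * u)%g.
Proof.
rewrite fsfunE; case: ifP => // /negbT fgu; apply/esym/big1_seq => s /= sf.
case: (finsuppP g) => [_|tg]; first by rewrite mulr0.
case/negP: fgu; apply/imfset2P; exists s => //; exists (s^-1 * u)%g => //.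
by rewrite mulVKg.
Qed.

Fact gr_mulEw (A : {fset G}) f g u : finsupp f `<=` A ->
  gr_mul f g u = \sum_(s <- A) f s * g (s^-1 * u)%g.
Proof.
move=> fA; rewrite gr_mulE (big_fset_incl _ fA)// => s _ sf.
by rewrite fsfun_dflt ?mul0r.
Qed.

Fact gr_addA : associative gr_add.
Proof. by move=> f g h; apply/fsfunP => s; rewrite !gr_addE addrA. Qed.

Fact gr_addC : commutative gr_add.
Proof. by move=> f g; apply/fsfunP => s; rewrite !gr_addE addrC. Qed.

Fact gr_add0 : left_id ([fsfun] : grpring) gr_add.
Proof. by move=> f; apply/fsfunP => s; rewrite gr_addE fsfun0E add0r. Qed.

Fact gr_addN : left_inverse ([fsfun] : grpring) gr_opp gr_add.
Proof.
by move=> f; apply/fsfunP => s; rewrite gr_addE gr_oppE fsfun0E addNr.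
Qed.

HB.instance Definition _ :=
  GRing.isZmodule.Build grpring gr_addA gr_addC gr_add0 gr_addN.

Fact gr_mulDl : left_distributive gr_mul +%R.
Proof.
move=> f g h; apply/fsfunP => u; rewrite [RHS]gr_addE.
pose A := finsupp (f + g) `|` (finsupp f `|` finsupp g).
rewrite !(@gr_mulEw A) /A ?fsubsetUl//.
- rewrite -big_split; apply: eq_bigr => s _ /=.
  by rewrite [(f + g) s]gr_addE mulrDl.
- by rewrite fsetUA fsetUC fsubsetUl.
- by rewrite fsetUA fsetUAC fsetUC fsubsetUl.
Qed.

Fact gr_mulDr : right_distributive gr_mul +%R.
Proof.
move=> f g h; apply/fsfunP => u; rewrite [RHS]gr_addE !gr_mulE -big_split.
by apply: eq_bigr => s _; rewrite [(g + h) _]gr_addE mulrDr.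
Qed.

Fact gr_mono_mul a s f u : gr_mul (gr_mono a s) f u = a * f (s^-1 * u)%g.
Proof.
rewrite (@gr_mulEw [fset s]) ?big_seq_fset1 ?gr_monoE ?eqxx//.
apply/fsubsetP => t; rewrite mem_finsupp gr_monoE inE.
by case: (t == s) => //; rewrite eqxx.
Qed.

Fact gr_mul1l : left_id (gr_mono 1 1%g) gr_mul.
Proof.
by move=> f; apply/fsfunP => u; rewrite gr_mono_mul mul1r invg1 mul1g.
Qed.

Fact gr_mul1r : right_id (gr_mono 1 1%g) gr_mul.
Proof.
move=> f; apply/fsfunP => u.
rewrite (@gr_mulEw (u |` finsupp f)) ?fsubsetUr//.
rewrite (big_fsetD1 u) ?inE ?eqxx//= mulVg gr_monoE eqxx mulr1.
rewrite big1_fset ?addr0// => s; rewrite !inE => /andP[su _] _.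
rewrite gr_monoE -[1%g](mulVg s) (inj_eq (mulgI _)) eq_sym (negPf su).
by rewrite mulr0.
Qed.

Fact gr_mulA : associative gr_mul.
Proof.
move=> f g h; apply/fsfunP => u.
rewrite gr_mulE.
rewrite (@gr_mulEw [fset (s * t)%g | s in finsupp f, t in finsupp g]); last first.
  apply/fsubsetP => v; rewrite mem_finsupp => fg0; apply/negPn/negP => nv.
  by move: fg0; rewrite fsfunE (negPf nv) eqxx.
under [RHS]eq_bigr do rewrite gr_mulE mulr_suml.
rewrite exchange_big/= big_seq [RHS]big_seq; apply: eq_bigr => s sf.
rewrite (@gr_mulEw [fset (s^-1 * t)%g | t in
    [fset (s * t)%g | s in finsupp f, t in finsupp g]]); last first.
  apply/fsubsetP => t tg; apply/imfsetP; exists (s * t)%g; rewrite ?mulKg//.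
  by apply/imfset2P; exists s => //; exists t.
rewrite big_imfset/=; last by move=> x y _ _; exact: mulgI.
rewrite mulr_sumr; apply: eq_bigr => t _.
by rewrite mulrA invgM invgK mulgA mulgK.
Qed.

HB.instance Definition _ := GRing.Zmodule_isPzRing.Build grpring
  gr_mulA gr_mul1l gr_mul1r gr_mulDl gr_mulDr.

End GroupRing.
Arguments gr_mono {R G} a s.

Section RestrictionOfScalars.
Variables (R : pzRingType) (G : groupType) (M : lmodType (grpring R G)).

(* An R[G]-module seen as an R-module through a |-> a 1_G. *)
Definition resscal : Type := M.
HB.instance Definition _ := GRing.Zmodule.on resscal.

Definition resscal_scale (a : R) (x : resscal) : resscal :=
  gr_mono a 1%g *: (x : M).

Fact resscal_scaleA a b x :
  resscal_scale a (resscal_scale b x) = resscal_scale (a * b) x.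
Proof.
rewrite /resscal_scale scalerA; congr (_ *: _); apply/fsfunP => u.
by rewrite [LHS]gr_mono_mul !gr_monoE invg1 mul1g; case: eqP; rewrite ?mulr0.
Qed.

Fact resscal_scale1 : left_id 1 resscal_scale.
Proof. by move=> x; apply: scale1r. Qed.

Fact resscal_scaleDr : right_distributive resscal_scale +%R.
Proof. by move=> a x y; apply: scalerDr. Qed.

Fact resscal_scaleDl x : {morph resscal_scale^~ x : a b / a + b}.
Proof.
move=> a b; rewrite /resscal_scale -[RHS]scalerDl; congr (_ *: _).
by apply/fsfunP => u; rewrite [RHS]gr_addE !gr_monoE; case: eqP; rewrite ?addr0.
Qed.

HB.instance Definition _ := GRing.Zmodule_isLmodule.Build R resscal
  resscal_scaleA resscal_scale1 resscal_scaleDr resscal_scaleDl.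

Definition gr_act (s : G) (x : resscal) : resscal := gr_mono 1 s *: (x : M).

End RestrictionOfScalars.

Section SigmaBar.
Variables (R : pzRingType) (G : groupType) (d : nat) (sigma : G -> 'S_d).

(* R^d is {ffun 'I_d -> R^o}; the scalars of R act on the left, the coefficients
   of g multiply on the right. *)
Definition sigma_bar (g : grpring R G) (w : {ffun 'I_d -> R^o}) :
    {ffun 'I_d -> R^o} :=
  [ffun v => \sum_(s <- finsupp g) (w (sigma s v) : R) * g s].

(* (R^d)^(1 x m) is {ffun 'I_m -> R^d}: matrices over a module are not a module
   in the library. *)
Definition sigma_bar_mx m n (f : 'M[grpring R G]_(m, n))
    (w : {ffun 'I_m -> {ffun 'I_d -> R^o}}) : {ffun 'I_n -> {ffun 'I_d -> R^o}} :=
  [ffun j => \sum_(k < m) sigma_bar (f k j) (w k)].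

Fact sigma_bar_linear g : linear (sigma_bar g).
Proof.
move=> a x y; apply/ffunP => v; rewrite !ffunE scaler_sumr -big_split.
by apply: eq_bigr => s _; rewrite !ffunE [(_ + _ : R^o)]/(_ + _ : R) mulrDl -mulrA.
Qed.

HB.instance Definition _ g :=
  GRing.isLinear.Build R _ _ *:%R (sigma_bar g) (sigma_bar_linear g).

Fact sigma_bar_mx_linear m n (f : 'M_(m, n)) : linear (sigma_bar_mx f).
Proof.
move=> a x y; apply/ffunP => j; rewrite !ffunE scaler_sumr -big_split.
by apply: eq_bigr => k _; rewrite !ffunE linearP.
Qed.

HB.instance Definition _ m n (f : 'M_(m, n)) :=
  GRing.isLinear.Build R _ _ *:%R (sigma_bar_mx f) (sigma_bar_mx_linear f).

End SigmaBar.

Section Nets.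
Variables (disp : Order.disp_t) (J : preorderType disp).

Definition directed_set : Prop :=
  [set: J] !=set0 /\ forall i j : J, exists k, (i <= k)%O /\ (j <= k)%O.

(* Convergence of a net indexed by J is convergence along the filter of tails. *)
Definition net_tails : set_system J :=
  filter_from [set: J] (fun j => [set i | (j <= i)%O]).

Definition free_ultrafilter (omega : set_system J) : Prop :=
  UltraFilter omega /\ forall j : J, omega [set i | (j <= i)%O].

(* The product of permutations in the library is the reverse of composition, so
   sigma_s sigma_t v is written as an iterated application. *)
Record sofic_approximation (K : realType) (G : groupType) (d : J -> nat)
    (sigma : forall i, G -> 'S_(d i)) : Prop := SoficApproximation {
  sofic_mul : forall s t : G,
    (#|[pred v : 'I_(d i) | sigma i s (sigma i t v) == sigma i (s * t)%g v]|%:R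
       / (d i)%:R : K) @[i --> net_tails] --> (1 : K);
  sofic_free : forall s t : G, s <> t ->
    (#|[pred v : 'I_(d i) | sigma i s v != sigma i t v]|%:R / (d i)%:R : K)
      @[i --> net_tails] --> (1 : K);
  sofic_dim : d i @[i --> net_tails] --> \oo
}.

End Nets.

Section MeanLength.
Variables (K : realType) (R : pzRingType) (L : lmodType R -> \bar K).
Variables (G : groupType) (M2 : lmodType (grpring R G)).
Local Notation rM2 := (resscal M2).

Definition delta_at d (v : 'I_d) (x : rM2) : {ffun 'I_d -> rM2} :=
  [ffun u => if u == v then x else 0].

Definition sofic_rel (B : {pred rM2}) (F : {fset G}) d (sigma : G -> 'S_d) :
    {pred {ffun 'I_d -> rM2}} :=
  span_mod [set w | exists v b s, [/\ b \in B, s \in F &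
    w = delta_at v b - delta_at (sigma s v) (gr_act s b)]].

HB.instance Definition _ B F d (sigma : G -> 'S_d) :=
  GRing.SubmodClosed.on (sofic_rel B F sigma).

(* The image of A^d in the quotient of M2^d by [sofic_rel B F sigma]. *)
Definition sofic_mod (A : {pred rM2}) (B : {pred rM2}) (F : {fset G})
    d (sigma : G -> 'S_d) : {pred quotmod (sofic_rel B F sigma)} :=
  image_mod (@quot_pi _ _ (sofic_rel B F sigma)) (submod_pow A d).
Arguments sofic_mod A B F {d} sigma.

HB.instance Definition _ (A : submodClosed rM2) B F d (sigma : G -> 'S_d) :=
  GRing.SubmodClosed.on (sofic_mod A B F sigma).

(* A finitely generated R-submodule of M1 is taken as one of M2 contained in M1.
   Limits are in \bar K, in which every function converges along an
   ultrafilter. *)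
Definition mean_length (M1 : submodClosed M2) (J : Type) (d : J -> nat)
    (sigma : forall i, G -> 'S_(d i)) (omega : set_system J) : \bar K :=
  ereal_sup [set
    ereal_inf [set
      ereal_inf [set
        lim (L (submod (sofic_mod A B F (sigma i))) * ((d i)%:R^-1)%:E @[i --> omega])%E
      | F in [set: {fset G}]]
    | B in [set B : submodClosed rM2 | fin_gen B]]
  | A in [set A : submodClosed rM2 | fin_gen A /\ {subset A <= M1}]].

End MeanLength.
Arguments delta_at {R G M2 d} v x.
Arguments sofic_rel {R G M2} B F {d} sigma.
Arguments sofic_mod {R G M2} A B F {d} sigma.

(* Main.v *)
Require Import Defs.
From HB Require Import structures.
From mathcomp Require Import all_boot all_order all_algebra.
From mathcomp Require Import perm finmap.
From mathcomp Require Import all_classical all_reals.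
From mathcomp Require Import ereal topology normedtype sequences.
Import Order.TTheory GRing.Theory Num.Theory.
Import numFieldNormedType.Exports.
Local Open Scope classical_set_scope.
Local Open Scope ring_scope.

(** The mean length is computed by comparing the quotient of M2^d by the sofic
    relations with (R^d)^n, through two R-linear maps depending on sigma.

    In M2^d modulo the relations delta_v b - delta_(sigma_s v) (s b), the
    element delta_v (s e_j) equals delta_u e_j with u = sigma_s^-1 v as soon as
    e_j and s are taken into account by the relations.  This suggests the map
    [pullback] from M2^d to (R^d)^n that sends delta_v (s e_j) to the standard
    vector of (R^d)^n at (j, sigma_s^-1 v); in the other direction,
    [lin_comb std_basis] sends that vector to delta_u e_j. Moreover
    [pullback] sends delta_v f_k, with f_k the k-th row of f, to the image under
    sigma_bar_f of the standard vector at (k, v) ([pullback_lin_comb]).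

    Upper bound.  A finitely generated A inside M1 is spanned by combinations of
    finitely many translates t f_k. Let B contain the e_j and the f_k, and let
    F contain those t and the supports of the entries of f. Modulo the relations
    delta_v (t f_k) = delta_u f_k, and delta_u f_k is the image under
    [lin_comb std_basis] of its [pullback], which lies in the range of
    sigma_bar_f.  Hence the length of the image of A^d is at most that of the
    range of sigma_bar_f, for every single sigma ([length_sofic_mod_le]).

    Lower bound.  Take for A the span of the rows of f, so that [pullback] maps
    A^d onto the range of sigma_bar_f.  For any B and F, [pullback] kills the
    relation attached to v, b and s unless sigma_s sigma_t u <> sigma_(st) u for
    u = sigma_t^-1 v and some t in the support of b.  The image of the relations
    is therefore spanned by o(d) elements, each contributing at most L(R) to the
    length, and the range of sigma_bar_f is no longer than the image of A^d in
    the quotient, up to o(d) ([length_sigma_bar_le]). Dividing by d and taking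
    the limit along the ultrafilter gives the claim; such limits exist in \bar K
    because the extended real line is compact ([ultra_cvg_ereal]). *)

Set Implicit Arguments.
Unset Strict Implicit.
Unset Printing Implicit Defensive.

(** * Limits of extended reals along an ultrafilter *)

(** The limit is the supremum of the values that u eventually exceeds: the
    ultrafilter decides, for every x, whether u is eventually above or
    eventually below x. *)
Lemma ultra_cvg_ereal (K : realType) (T : Type) (F : set_system T)
    (u : T -> \bar K) : UltraFilter F -> cvg (u x @[x --> F]).
Proof.
move=> UF; have FF : ProperFilter F by exact: ultra_proper.
pose S := [set x : \bar K | F [set t | (x <= u t)%E]].
have below x : (x < ereal_sup S)%E -> F [set t | (x <= u t)%E].
  move=> /ereal_sup_gt[y Sy xy]; apply: filterS Sy => t /=.
  by move=> yt; apply: le_trans yt; exact: ltW.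
have above x : (ereal_sup S < x)%E -> F [set t | (u t < x)%E].
  move=> ltx; have [Fx|] := in_ultra_setVsetC [set t | (x <= u t)%E] UF.
    by move: ltx; rewrite ltNge ereal_sup_ubound.
  by apply: filterS => t /= /negP; rewrite -ltNge.
case E : (ereal_sup S) below above => [r| |] below above.
- apply/cvg_ex; exists r%:E => A /= [e e0 reA]; rewrite /nbhs/=.
  have lo : F [set t | ((r - e / 2)%:E <= u t)%E].
    by apply: below; rewrite lte_fin ltrBlDr ltrDl divr_gt0.
  have hi : F [set t | (u t < (r + e)%:E)%E].
    by apply: above; rewrite lte_fin ltrDl.
  apply: filterS2 lo hi => t /=; case: (u t) => [y| |] //=.
  rewrite lee_fin lte_fin => ly yh; apply: reA => /=.
  rewrite distrC ltr_distl yh andbT; apply: lt_le_trans ly.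
  by rewrite ltrD2l ltrN2 ltr_pdivrMr// ltr_pMr// ltr1n.
- apply/cvg_ex; exists +oo%E; apply/cvgeyPge => A.
  by apply: below; rewrite ltry.
- apply/cvg_ex; exists -oo%E; apply/cvgeNyPlt => A.
  by apply: above; rewrite ltNyr.
Qed.

(** The index type carries no topology, so the comparison of limits is made
    along the image filter on pairs of values. *)
Lemma le_lim_ereal (K : realType) (T : Type) (F : set_system T)
    (u v : T -> \bar K) : ProperFilter F ->
  cvg (u x @[x --> F]) -> cvg (v x @[x --> F]) ->
  (\forall x \near F, u x <= v x)%E ->
  (lim (u x @[x --> F]) <= lim (v x @[x --> F]))%E.
Proof.
move=> FF cu cv uv; pose uvF := ((fun x => (u x, v x)) @ F)%classic.
exact: (@lee_lim _ uvF _ _ fst snd).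
Qed.

(** * Submodules and length functions *)

Section Submodules.
Variable R : pzRingType.
Implicit Types M : lmodType R.

Lemma span_sub M (X : set M) (N : submodClosed M) :
  (forall x, X x -> x \in N) -> {subset span_mod X <= N}.
Proof. by move=> XN x /asboolP; apply. Qed.

Lemma mem_span M (X : set M) x : X x -> x \in span_mod X.
Proof. by move=> Xx; apply/asboolP => N; apply. Qed.

Section Maps.
Variables (M M' : lmodType R).

Definition equalizer_mod (phi psi : {linear M -> M'}) : {pred M} :=
  fun x => phi x == psi x.

Fact equalizer_mod_closed phi psi : subsemimod_closed (equalizer_mod phi psi).
Proof.
split; first split; rewrite /equalizer_mod.
- by rewrite unfold_in !linear0.
- by move=> x y /eqP xE /eqP yE; rewrite unfold_in !linearD xE yE.
- by move=> a x /eqP xE; rewrite unfold_in !linearZ/= xE.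
Qed.

HB.instance Definition _ phi psi :=
  GRing.isSubmodClosed.Build R M (equalizer_mod phi psi)
    (equalizer_mod_closed phi psi).

Definition preim_mod (phi : {linear M -> M'}) (N : {pred M'}) : {pred M} :=
  fun x => phi x \in N.

Fact preim_mod_closed phi (N : submodClosed M') :
  subsemimod_closed (preim_mod phi N).
Proof.
split; first split; rewrite /preim_mod.
- by rewrite unfold_in linear0 rpred0.
- by move=> x y Nx Ny; rewrite unfold_in linearD rpredD.
- by move=> a x Nx; rewrite unfold_in linearZ rpredZ.
Qed.

HB.instance Definition _ phi (N : submodClosed M') :=
  GRing.isSubmodClosed.Build R M (preim_mod phi N) (preim_mod_closed phi N).

Section Corestriction.
Variables (phi : {linear M -> M'}) (N : submodClosed M').
Hypothesis phiN : forall x, phi x \in N.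

Definition corestr (x : M) : submod N := Sub (phi x) (phiN x).

Fact corestr_linear : linear corestr.
Proof. by move=> a x y; apply: val_inj; rewrite linearP/= linearP. Qed.

HB.instance Definition _ :=
  GRing.isLinear.Build R M (submod N) *:%R corestr corestr_linear.

End Corestriction.

Definition scale_at (x : M) (a : R^o) : M := (a : R) *: x.

Fact scale_at_linear x : linear (scale_at x).
Proof. by move=> a b c; rewrite /scale_at scalerDl scalerA. Qed.

HB.instance Definition _ x :=
  GRing.isLinear.Build R R^o M *:%R (scale_at x) (scale_at_linear x).

End Maps.
End Submodules.

Lemma quot_pi_eq0 (R : pzRingType) (M : lmodType R) (N : submodClosed M) x :
  (quot_pi N x == 0) = (x \in N).
Proof. by rewrite -(linear0 (quot_pi N)) quot_pi_eq subr0. Qed.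

Section Length.
Variables (K : realType) (R : pzRingType) (L : lmodType R -> \bar K).
Hypothesis lenL : length_function L.
Implicit Types M : lmodType R.

Lemma length_inj M1 M2 (i : {linear M1 -> M2}) :
  injective i -> (L M1 <= L M2)%E.
Proof.
move=> inji; pose Q := quotmod (range_mod i).
rewrite (@length_exact _ _ _ lenL _ _ Q i (quot_pi (range_mod i))) //.
- by rewrite leeDl// length_ge0.
- apply/seteqP; split=> x /=.
  + by move=> rx; apply/eqP; rewrite quot_pi_eq0; apply/asboolP.
  + by move/eqP; rewrite quot_pi_eq0 => /asboolP.
- by apply/seteqP; split=> // q _; exists (repr q) => //; exact: quot_piK.
Qed.

Lemma length_ker_surj M1 M2 (p : {linear M1 -> M2}) :
  range p = [set: M2] -> L M1 = (L (submod (equalizer_mod p \0)) + L M2)%E.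
Proof.
move=> surjp.
pose i : {linear submod (equalizer_mod p \0) -> M1} := val.
apply: (@length_exact _ _ _ lenL _ _ _ i p) => //.
apply/seteqP; split=> x /=.
- by move=> [y _ <-]; have /eqP := valP y.
- by move=> /eqP px0; exists (exist _ x px0 : submod (equalizer_mod p \0)).
Qed.

Lemma length_surj M1 M2 (p : {linear M1 -> M2}) :
  range p = [set: M2] -> (L M2 <= L M1)%E.
Proof.
by move=> /length_ker_surj ->; rewrite leeDr// length_ge0.
Qed.

Lemma length_sub M (N1 N2 : submodClosed M) :
  {subset N1 <= N2} -> (L (submod N1) <= L (submod N2))%E.
Proof.
move=> N12; have sub x : val (x : submod N1) \in N2 by apply/N12/valP.
apply: (@length_inj _ _ (corestr sub)) => x y /(congr1 val) /=.
exact: val_inj.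
Qed.

Lemma surj_corestr_range M1 M2 (phi : {linear M1 -> M2})
    (sub : forall x, phi x \in range_mod phi) :
  range (corestr sub) = [set: submod (range_mod phi)].
Proof.
apply/seteqP; split=> // y _; have /asboolP[x _ xy] := valP y.
by exists x => //; apply: val_inj.
Qed.

Lemma mem_range_mod M1 M2 (phi : {linear M1 -> M2}) x : phi x \in range_mod phi.
Proof. by apply/asboolP; exists x. Qed.

Lemma length_range M1 M2 (phi : {linear M1 -> M2}) :
  (L (submod (range_mod phi)) <= L M1)%E.
Proof. exact/length_surj/(surj_corestr_range (mem_range_mod phi)). Qed.

Lemma length_image M1 M2 (phi : {linear M1 -> M2}) (N : submodClosed M1) :
  (L (submod (image_mod phi N)) <= L (submod N))%E.
Proof.
apply: le_trans (length_range (phi \o (val : submod N -> M1))).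
apply: length_sub => _ /asboolP[x Nx ->]; apply/asboolP.
by exists (Sub x Nx).
Qed.

Lemma length_le_image M1 M2 (phi : {linear M1 -> M2}) (E : submodClosed M1)
    (N : submodClosed M2) :
  {subset N <= image_mod phi E} -> (L (submod N) <= L (submod E))%E.
Proof. by move=> /length_sub/le_trans; apply; exact: length_image. Qed.

(** Subadditivity: the kernel of E -> M / W embeds in W. *)
Lemma length_split M (E W : submodClosed M) :
  (L (submod E) <= L (submod W) + L (submod (image_mod (quot_pi W) E)))%E.
Proof.
have sub x : (quot_pi W \o (val : submod E -> M)) x \in image_mod (quot_pi W) E.
  by apply/asboolP; exists (val x) => //; exact: valP.
have surj : range (corestr sub) = [set: submod (image_mod (quot_pi W) E)].
  apply/seteqP; split=> // y _; have /asboolP[x Ex xy] := valP y.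
  by exists (Sub x Ex) => //; apply: val_inj.
rewrite (length_ker_surj surj) leeD2r//.
have kerW (x : submod (equalizer_mod (corestr sub) \0)) : val (val x) \in W.
  by have /eqP/(congr1 val)/eqP := valP x; rewrite quot_pi_eq0.
pose i : {linear _ -> _} :=
  (val : submod E -> M) \o (val : submod (equalizer_mod (corestr sub) \0) -> _).
apply: (@length_inj _ _ (@corestr _ _ _ i W kerW)) => x y /(congr1 val) xy.
by apply/val_inj/val_inj.
Qed.

(** The hypothesis makes beta factor through alpha, so that the range of alpha
    surjects onto the range of beta. *)
Lemma length_range_ker M M1 M2 (alpha : {linear M -> M1})
    (beta : {linear M -> M2}) :
  (forall x, alpha x = 0 -> beta x = 0) ->
  (L (submod (range_mod beta)) <= L (submod (range_mod alpha)))%E.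
Proof.
move=> ker.
have kerE x y : alpha x = alpha y -> beta x = beta y.
  by move=> axy; apply/eqP; rewrite -subr_eq0 -linearB ker// linearB axy subrr.
have lift (y : submod (range_mod alpha)) : {x | alpha x = val y}.
  by apply/cid; have /asboolP[x _ xy] := valP y; exists x.
pose gamma y : submod (range_mod beta) :=
  corestr (mem_range_mod beta) (sval (lift y)).
have gamma_lin : linear gamma.
  move=> a x y; apply: val_inj; rewrite [RHS](linearP val)/= -linearP.
  apply: kerE.
  by rewrite linearP (svalP (lift _)) (svalP (lift _)) (svalP (lift _)) linearP.
pose g : {linear _ -> _} :=
  HB.pack gamma (GRing.isLinear.Build _ _ _ _ _ gamma_lin).
apply: (@length_surj _ _ g); apply/seteqP; split=> // y _.
have /asboolP[x _ xy] := valP y.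
exists (corestr (mem_range_mod alpha) x) => //; apply: val_inj => /=.
by rewrite -xy; apply: kerE; rewrite (svalP (lift _)).
Qed.

(** Splitting phi A along phi D, the part in phi D is controlled by phi D, and
    the rest is a quotient of the image of A in M / D. This comparison yields
    the lower bound for the mean length, with phi D small. *)
Lemma length_image_quot M M' (phi : {linear M -> M'}) (A D : submodClosed M) :
  (L (submod (image_mod phi A)) <=
   L (submod (image_mod (quot_pi D) A)) + L (submod (image_mod phi D)))%E.
Proof.
rewrite addeC; apply: le_trans (length_split _ (image_mod phi D)) _.
rewrite leeD2l//.
pose v : {linear submod A -> M} := val.
pose alpha : {linear submod A -> _} := quot_pi D \o v.
pose beta : {linear submod A -> _} := quot_pi (image_mod phi D) \o (phi \o v).
apply: (@le_trans _ _ (L (submod (range_mod beta)))).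
  apply: length_sub => _ /asboolP[_ /asboolP[x Ax ->] ->].
  by apply/asboolP; exists (Sub x Ax).
apply: (@le_trans _ _ (L (submod (range_mod alpha)))).
  apply: length_range_ker => x /eqP; rewrite /= quot_pi_eq0 => Dx.
  by apply/eqP; rewrite quot_pi_eq0; apply/asboolP; exists (v x).
apply: length_sub => _ /asboolP[x _ <-]; apply/asboolP.
by exists (v x) => //; exact: valP.
Qed.

(** Each generator adds a cyclic module, that is, a quotient of R. *)
Lemma length_span_seq M (s : seq M) :
  (L (submod (span_mod [set` s])) <= (size s)%:R%:E * L R^o)%E.
Proof.
elim: s => [|x s IHs].
  rewrite mul0e length_zero// => x; apply: val_inj.
  have : {subset span_mod [set` [::]] <=
      equalizer_mod (idfun : M -> M) \0} by exact: span_sub.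
  by move=> /(_ _ (valP x)) /eqP.
rewrite /= -natr1 EFinD ge0_muleDl// mul1e.
apply: le_trans (length_split _ (span_mod [set` s])) _; apply: leeD => //.
apply: le_trans (length_range (scale_at (quot_pi (span_mod [set` s]) x))).
apply: length_sub => _ /asboolP[y ys ->].
suff sub : {subset span_mod [set` x :: s] <=
    preim_mod (quot_pi (span_mod [set` s]))
      (range_mod (scale_at (quot_pi (span_mod [set` s]) x)))} by exact: sub.
apply: span_sub => z /=; rewrite inE => /orP[/eqP ->|zs].
  by apply/asboolP; exists 1 => //; exact: scale1r.
apply/asboolP; exists 0 => //; rewrite [LHS]linear0; apply/esym/eqP.
by rewrite quot_pi_eq0 mem_span.
Qed.

End Length.

(** * The group ring and restriction of scalars *)

Section GroupRingSums.
Variables (R : pzRingType) (G : groupType).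
Implicit Types (g : grpring R G) (P : pred G).

Lemma grDE g g' s : (g + g' : grpring R G) s = g s + g' s.
Proof. exact: gr_addE. Qed.

Lemma gr_monoM (a : R) s g u :
  (gr_mono a s * g : grpring R G) u = a * g (s^-1 * u)%g.
Proof. exact: gr_mono_mul. Qed.

(** The functionals on the group ring through which [pullback] is defined. *)
Definition gr_sum P g : R := \sum_(s <- finsupp g | P s) g s.

Lemma gr_sumEw (A : {fset G}) P g : {subset finsupp g <= A} ->
  gr_sum P g = \sum_(s <- A | P s) g s.
Proof.
move=> /fsubsetP gA; rewrite /gr_sum big_mkcond [RHS]big_mkcond/=.
rewrite (big_fset_incl _ gA)//= => s _ sg.
by rewrite fsfun_dflt// if_same.
Qed.

Lemma gr_sum_mono P (a : R) s : gr_sum P (gr_mono a s) = if P s then a else 0.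
Proof.
rewrite (@gr_sumEw [fset s]%fset) => [|t]; last first.
  by rewrite mem_finsupp gr_monoE inE; case: (t == s) => //; rewrite eqxx.
by rewrite big_mkcond big_seq_fset1/= gr_monoE eqxx.
Qed.

Lemma gr_sum_act P s g :
  gr_sum P (gr_mono 1 s * g) = gr_sum (fun t => P (s * t)%g) g.
Proof.
rewrite (@gr_sumEw [fset (s * t)%g | t in finsupp g]%fset) => [|u].
  rewrite big_mkcond big_imfset/=; last by move=> x y _ _; exact: mulgI.
  rewrite [RHS]big_mkcond/=; apply: eq_bigr => t _.
  by rewrite gr_monoM mul1r mulKg.
rewrite mem_finsupp gr_monoM mul1r => gsu.
by apply/imfsetP; exists (s^-1 * u)%g; rewrite /= ?mem_finsupp// mulVKg.
Qed.

Lemma gr_sum_linear P (a : R) g g' :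
  gr_sum P (gr_mono a 1%g * g + g') = a * gr_sum P g + gr_sum P g'.
Proof.
pose A := (finsupp g `|` finsupp g')%fset.
rewrite !(@gr_sumEw A) => [|s gs|s gs|s]; last first.
- rewrite mem_finsupp; apply: contraR; rewrite inE => /norP[gs g's].
  rewrite grDE gr_monoM invg1 mul1g.
  by rewrite !fsfun_dflt// mulr0 addr0.
- by rewrite inE gs.
- by rewrite inE gs orbT.
rewrite mulr_sumr -big_split/=; apply: eq_bigr => s _.
by rewrite grDE gr_monoM invg1 mul1g.
Qed.

Lemma resscalE (M : lmodType (grpring R G)) a (x : resscal M) :
  a *: x = gr_mono a 1%g *: (x : M).
Proof. by []. Qed.

(** Reduces membership in R-submodules of elements given by group ring
    coefficients to translates by group elements. *)
Lemma gr_scale_sum (M : lmodType (grpring R G)) g (y : resscal M) :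
  g *: (y : M) = \sum_(s <- finsupp g) (g s *: gr_act s y : resscal M).
Proof.
have {1}-> : g = \sum_(s <- finsupp g) gr_mono (g s) s.
  apply/fsfunP => u.
  have -> : (\sum_(s <- finsupp g) gr_mono (g s) s) u =
            \sum_(s <- finsupp g) gr_mono (g s) s u.
    elim/big_rec2: _ => [|s a b _ <-]; first by rewrite fsfun0E.
    exact: grDE.
  case: (finsuppP g u) => [gu|gu].
    rewrite big1_seq// => s /= sg; rewrite gr_monoE.
    by case: eqP => // us; move: gu; rewrite us sg.
  rewrite (big_fsetD1 u)//= gr_monoE eqxx big1_fset ?addr0// => s.
  by rewrite !inE gr_monoE eq_sym => /andP[/negPf ->].
rewrite scaler_suml; apply: eq_bigr => s _.
rewrite resscalE scalerA; congr (_ *: _).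
apply/fsfunP => u; rewrite gr_monoM !gr_monoE invg1 mul1g.
by case: eqP; rewrite ?mulr1 ?mulr0.
Qed.

Fact gr_act_linear (M : lmodType (grpring R G)) s : linear (@gr_act R G M s).
Proof.
move=> a x y; rewrite /gr_act !resscalE scalerDr !scalerA.
have -> // : gr_mono 1 s * gr_mono a 1%g = gr_mono a 1%g * gr_mono 1 s.
apply/fsfunP => u; rewrite !gr_monoM !gr_monoE invg1 mul1g mul1r.
rewrite -(inj_eq (mulgI s)) mulVKg mulg1.
by case: eqP; rewrite ?mulr1 ?mulr0.
Qed.

HB.instance Definition _ (M : lmodType (grpring R G)) s :=
  GRing.isLinear.Build R (resscal M) (resscal M) *:%R (@gr_act R G M s)
    (gr_act_linear s).

End GroupRingSums.

(** * Linear maps out of M^d and the sofic relations *)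

Section Combinations.
Variables (R : pzRingType) (M : lmodType R) (m d : nat) (r : 'I_m -> M).

(** The linear map that sends the standard vector at (k, v) to delta_v (r k). *)
Definition lin_comb (x : {ffun 'I_m -> {ffun 'I_d -> R^o}}) :
    {ffun 'I_d -> M} :=
  [ffun v => \sum_(k < m) (x k v : R) *: r k].

Fact lin_comb_linear : linear lin_comb.
Proof.
move=> a x y; apply/ffunP => v; rewrite !ffunE scaler_sumr -big_split.
by apply: eq_bigr => k _; rewrite !ffunE scalerDl scalerA.
Qed.

HB.instance Definition _ :=
  GRing.isLinear.Build R _ _ *:%R lin_comb lin_comb_linear.

Definition unit_at (k : 'I_m) (v : 'I_d) : {ffun 'I_m -> {ffun 'I_d -> R^o}} :=
  [ffun k' => [ffun v' => if (k' == k) && (v' == v) then 1 else 0]].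

End Combinations.

Section Delta.
Variables (R : pzRingType) (G : groupType) (M : lmodType (grpring R G)).
Local Notation rM := (resscal M).
Variable (d : nat).

Fact delta_at_linear (v : 'I_d) : linear (@delta_at R G M d v).
Proof.
move=> a x y; apply/ffunP => u; rewrite !ffunE; case: ifP => // _.
by rewrite scaler0 addr0.
Qed.

HB.instance Definition _ v :=
  GRing.isLinear.Build R rM {ffun 'I_d -> rM} *:%R (delta_at v)
    (delta_at_linear v).

Lemma delta_sum (w : {ffun 'I_d -> rM}) : w = \sum_v delta_at v (w v).
Proof.
apply/ffunP => u; rewrite sum_ffunE (bigD1 u)//= ffunE eqxx big1 ?addr0// => v.
by rewrite ffunE eq_sym => /negPf ->.
Qed.

Lemma lin_comb_unit m (r : 'I_m -> rM) k (v : 'I_d) :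
  lin_comb r (unit_at R k v) = delta_at v (r k).
Proof.
apply/ffunP => u; rewrite !ffunE (bigD1 k)//= !ffunE eqxx/= big1 ?addr0.
  by case: ifP; rewrite ?scale1r ?scale0r.
by move=> k' /negPf k'k; rewrite !ffunE k'k scale0r.
Qed.

Lemma linear_ffunB (V : lmodType R) (phi : {linear {ffun 'I_d -> rM} -> V})
    w w' :
  phi (w - w') = phi w - phi w'.
Proof. exact: linearB. Qed.

Lemma linear_submod_pow (V : lmodType R) (phi : {linear {ffun 'I_d -> rM} -> V})
    (A : {pred rM}) (N : submodClosed V) w :
  (forall v a, a \in A -> phi (delta_at v a) \in N) ->
  w \in submod_pow A d -> phi w \in N.
Proof.
move=> AN /forallP Aw; rewrite (delta_sum w) linear_sum.
by apply: rpred_sum => v _; apply: AN.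
Qed.

Section SoficRel.
Variables (sigma : G -> 'S_d) (B : {pred rM}) (F : {fset G}).
Local Notation D := (sofic_rel B F sigma).

Lemma quot_delta_act b s v : b \in B -> s \in F ->
  quot_pi D (delta_at v (gr_act s b)) =
  quot_pi D (delta_at ((sigma s)^-1%g v) b).
Proof.
move=> Bb Fs; apply/esym/eqP; rewrite quot_pi_eq; apply: mem_span => /=.
by exists ((sigma s)^-1%g v), b, s; split=> //; rewrite permKV.
Qed.

(** The relation attached to v, b and s is linear in b, so only generators of B
    matter. *)
Lemma linear_sofic_rel (V : lmodType R) (phi : {linear {ffun 'I_d -> rM} -> V})
    (bs : seq rM) (N : submodClosed V) w :
  B =i span_mod [set` bs] ->
  (forall v b s, b \in bs -> s \in F ->
     phi (delta_at v b - delta_at (sigma s v) (gr_act s b)) \in N) ->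
  w \in D -> phi w \in N.
Proof.
move=> Bs relN; apply: (span_sub (N := preim_mod phi N)).
move=> _ [v [b [s [Bb Fs ->]]]]; move: Bb; rewrite Bs.
pose rel : {linear rM -> {ffun 'I_d -> rM}} :=
  @delta_at R G M d v \- (@delta_at R G M d (sigma s v) \o @gr_act R G M s).
by apply: (span_sub (N := preim_mod (phi \o rel) N)) => c cs; apply: relN.
Qed.

(** The range of beta lies in phi A^d, and phi A^d loses at most phi of the
    relations, which is covered by the span of gens, when it is compared with
    the image of A^d in the quotient by the relations. *)
Lemma length_range_le_sofic_mod (K : realType) (L : lmodType R -> \bar K)
    (X V : lmodType R) (phi : {linear {ffun 'I_d -> rM} -> V})
    (beta : {linear X -> V}) (alpha : X -> {ffun 'I_d -> rM})
    (A : submodClosed rM) (bs : seq rM) (gens : seq V) :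
  length_function L ->
  (forall x, alpha x \in submod_pow A d) ->
  (forall x, phi (alpha x) = beta x) ->
  B =i span_mod [set` bs] ->
  (forall v b s, b \in bs -> s \in F ->
     phi (delta_at v b - delta_at (sigma s v) (gr_act s b)) \in
     span_mod [set` gens]) ->
  (L (submod (range_mod beta)) <=
   L (submod (sofic_mod A B F sigma)) + (size gens)%:R%:E * L R^o)%E.
Proof.
move=> lenL alphaA phiE Bs relN.
apply: (@le_trans _ _ (L (submod (image_mod phi (submod_pow A d))))).
  apply: length_sub => // _ /asboolP[x _ <-].
  by rewrite -phiE; apply/asboolP; exists (alpha x).
apply: le_trans (length_image_quot lenL phi _ D) _; apply: leeD => //.
apply: le_trans (length_span_seq lenL gens).
apply: length_sub => // _ /asboolP[w Dw ->].
exact: (linear_sofic_rel Bs relN).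
Qed.

End SoficRel.
End Delta.

(** * The comparison map *)

Section Pullback.
Variables (R : pzRingType) (G : groupType) (n : nat).
Local Notation M2 := 'rV[grpring R G]_n.
Local Notation rM2 := (resscal M2).
Variables (d : nat) (sigma : G -> 'S_d).

Definition coord_sum (P : pred G) (j : 'I_n) (b : rM2) : R^o :=
  gr_sum P ((b : M2) 0 j).

Fact coord_sum_linear P j : linear (coord_sum P j).
Proof.
move=> a x y; apply: etrans (gr_sum_linear _ _ _ _).
by rewrite resscalE /coord_sum [in LHS]mxE [in LHS]mxE.
Qed.

HB.instance Definition _ P j :=
  GRing.isLinear.Build R rM2 R^o *:%R (coord_sum P j) (coord_sum_linear P j).

(** On w = delta_v (s e_j) the value is the standard vector at
    (j, sigma_s^-1 v): the coefficient of s in the j-th coordinate of w u is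
    collected at the points v such that sigma_s v = u. *)
Definition pullback (w : {ffun 'I_d -> rM2}) :
    {ffun 'I_n -> {ffun 'I_d -> R^o}} :=
  [ffun j => [ffun v => \sum_u coord_sum (fun s => sigma s v == u) j (w u)]].

Fact pullback_linear : linear pullback.
Proof.
move=> a x y; apply/ffunP => j; apply/ffunP => v; rewrite !ffunE.
rewrite scaler_sumr -big_split; apply: eq_bigr => u _ /=.
by rewrite !ffunE linearP.
Qed.

HB.instance Definition _ :=
  GRing.isLinear.Build R _ _ *:%R pullback pullback_linear.

Lemma pullback_delta v b j u :
  pullback (delta_at v b) j u = coord_sum (fun s => sigma s u == v) j b.
Proof.
rewrite !ffunE (bigD1 v)//= !ffunE eqxx big1 ?addr0// => w wv.
by rewrite ffunE (negPf wv) linear0.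
Qed.

End Pullback.

Section PullbackMatrix.
Variables (R : pzRingType) (G : groupType) (n d : nat) (sigma : G -> 'S_d).
Local Notation M2 := 'rV[grpring R G]_n.
Local Notation rM2 := (resscal M2).

Definition row_res m (f : 'M[grpring R G]_(m, n)) (k : 'I_m) : rM2 := row k f.

Definition std_basis (j : 'I_n) : rM2 := delta_mx 0 j : M2.

(** The identity that brings sigma_bar into play: the matrix f on M2^d and
    sigma_bar_f on (R^d)^n correspond to each other under [pullback]. *)
Lemma pullback_lin_comb m (f : 'M[grpring R G]_(m, n)) x :
  pullback sigma (lin_comb (row_res f) x) = sigma_bar_mx sigma f x.
Proof.
apply/ffunP => j; apply/ffunP => v; rewrite !ffunE sum_ffunE.
under eq_bigr do rewrite ffunE linear_sum.
rewrite exchange_big; apply: eq_bigr => k _ /=.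
rewrite ffunE (partition_big (fun s => sigma s v) xpredT)//=.
apply: eq_bigr => u _; rewrite linearZ/= /coord_sum /gr_sum !mxE.
by rewrite [LHS]mulr_sumr; apply: eq_bigr => s /eqP ->.
Qed.

Lemma coord_sum_act P j s (b : rM2) :
  coord_sum P j (gr_act s b) = coord_sum (fun t => P (s * t)%g) j b.
Proof. by rewrite /coord_sum -gr_sum_act mxE. Qed.

Lemma coord_sum_basis P j j' :
  coord_sum P j (std_basis j') = if (j == j') && P 1%g then 1 else 0.
Proof.
rewrite /coord_sum mxE /=; case: eqP => _ /=.
  exact: gr_sum_mono.
by rewrite /gr_sum big1 // => s _; rewrite fsfun0E.
Qed.

(** The t-th coefficient of b contributes to the first term at the u such that
    sigma_t u = v, and to the second at the u such that
    sigma_(st) u = sigma_s v; by hypothesis both conditions say that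
    u = sigma_t^-1 v. *)
Lemma pullback_rel_eq0 (T : {fset G}) (b : rM2) s v :
  (forall j, {subset finsupp ((b : M2) 0 j) <= T}) ->
  (forall t, t \in T ->
     sigma s v = sigma (s * t)%g ((sigma t)^-1%g v)) ->
  pullback sigma (delta_at v b - delta_at (sigma s v) (gr_act s b)) = 0.
Proof.
move=> bT good.
suff E : pullback sigma (delta_at v b) =
    pullback sigma (delta_at (sigma s v) (gr_act s b)).
  by rewrite linear_ffunB [X in X - _]E subrr.
apply/ffunP => j; apply/ffunP => u; rewrite !pullback_delta coord_sum_act.
rewrite /coord_sum /gr_sum big_seq_cond [RHS]big_seq_cond; apply: eq_bigl => t.
case: (boolP (t \in _)) => //= /bT /good ->.
by rewrite (inj_eq perm_inj) -[RHS](inj_eq (@perm_inj _ (sigma t))) permKV.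
Qed.

Lemma pullback_act_basis v s j :
  pullback sigma (delta_at v (gr_act s (std_basis j))) =
  unit_at R j ((sigma s)^-1%g v).
Proof.
apply/ffunP => j'; apply/ffunP => u; rewrite pullback_delta coord_sum_act.
rewrite coord_sum_basis mulg1 !ffunE.
by rewrite -[u == _](inj_eq (@perm_inj _ (sigma s))) permKV.
Qed.

Section Relations.
Variables (B : submodClosed rM2) (F : {fset G}).
Local Notation D := (sofic_rel B F sigma).
Local Notation q := (quot_pi D).

Hypothesis basisB : forall j, std_basis j \in B.

(** Modulo the relations, [lin_comb std_basis] is a left inverse of [pullback]
    on the elements with support in F; both sides are R-linear in b, so the case of
    a translate s e_j is enough. *)
Lemma quot_delta_pullback (b : rM2) v :
  (forall j, {subset finsupp ((b : M2) 0 j) <= F}) ->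
  q (delta_at v b) = q (lin_comb std_basis (pullback sigma (delta_at v b))).
Proof.
move=> bF; pose N : submodClosed rM2 := equalizer_mod
   (q \o @delta_at R G M2 d v)
   (q \o lin_comb std_basis \o pullback sigma \o @delta_at R G M2 d v).
suff : b \in N by move/eqP.
have -> : b = \sum_j \sum_(s <- finsupp ((b : M2) 0 j))
    ((b : M2) 0 j s *: gr_act s (std_basis j) : rM2).
  rewrite [LHS](row_sum_delta (b : M2)); apply: eq_bigr => j _.
  exact: gr_scale_sum.
apply: rpred_sum => j _; rewrite big_seq; apply: rpred_sum => s bs.
apply: rpredZ; apply/eqP => /=.
rewrite pullback_act_basis lin_comb_unit; apply: quot_delta_act.
  exact: basisB.
exact: bF bs.
Qed.

Variables (m : nat) (f : 'M[grpring R G]_(m, n)).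
Hypothesis rowB : forall k, row_res f k \in B.
Hypothesis entryF : forall k j, {subset finsupp (f k j) <= F}.

(** The upper bound as an inclusion: a relation turns delta_v (t f_k) into
    delta_u f_k, which is recovered from its [pullback], an element of the range
    of sigma_bar_f. *)
Lemma sofic_mod_sub (A : {pred rM2}) (s : seq rM2) :
  A =i span_mod [set` s] ->
  (forall a, a \in s -> exists2 h : 'rV[grpring R G]_m,
     (forall k, {subset finsupp (h 0 k) <= F}) & a = (h *m f : M2)) ->
  {subset sofic_mod A B F sigma <=
    image_mod (q \o lin_comb std_basis) (range_mod (sigma_bar_mx sigma f))}.
Proof.
move=> As sf.
set I := image_mod _ _.
have delta_row u k : q (delta_at u (row_res f k)) \in I.
  rewrite quot_delta_pullback => [|j]; last by rewrite mxE; exact: entryF.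
  apply/asboolP; exists (pullback sigma (delta_at u (row_res f k))) => //.
  rewrite -lin_comb_unit pullback_lin_comb; apply/asboolP.
  by exists (unit_at R k u).
have delta_A v a : a \in A -> q (delta_at v a) \in I.
  (* By linearity it suffices to treat the translates t f_k. *)
  rewrite As.
  apply: (span_sub (N := preim_mod (q \o @delta_at R G M2 d v) I)) => {}a /=.
  move=> /sf[h hF ->].
  have -> : (h *m f : M2) = \sum_k \sum_(t <- finsupp (h 0 k))
      (h 0 k t *: gr_act t (row_res f k) : rM2).
    rewrite [LHS](mulmx_sum_row h f); apply: eq_bigr => k _.
    exact: gr_scale_sum.
  apply: rpred_sum => k _; rewrite big_seq; apply: rpred_sum => t ht.
  apply: rpredZ; suff : q (delta_at v (gr_act t (row_res f k))) \in I by [].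
  rewrite quot_delta_act; [exact: delta_row | exact: rowB | exact: hF ht].
move=> _ /asboolP[w Aw ->].
exact: (linear_submod_pow (phi := q) (N := I) delta_A).
Qed.

Lemma length_sofic_mod_le (K : realType) (L : lmodType R -> \bar K)
    (A : submodClosed rM2) (s : seq rM2) :
  length_function L -> A =i span_mod [set` s] ->
  (forall a, a \in s -> exists2 h : 'rV[grpring R G]_m,
     (forall k, {subset finsupp (h 0 k) <= F}) & a = (h *m f : M2)) ->
  (L (submod (sofic_mod A B F sigma)) <=
   L (submod (range_mod (sigma_bar_mx sigma f))))%E.
Proof.
move=> lenL As sf.
exact: (length_le_image lenL (sofic_mod_sub As sf)).
Qed.

End Relations.
End PullbackMatrix.

(** * Counting the failures of multiplicativity *)

Section Defects.
Variables (R : pzRingType) (G : groupType) (n d : nat) (sigma : G -> 'S_d).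
Local Notation M2 := 'rV[grpring R G]_n.
Local Notation rM2 := (resscal M2).

Definition defect s t : nat :=
  #|[pred u | sigma s (sigma t u) != sigma (s * t)%g u]|.

(** The points where relations may survive under [pullback] are the
    sigma_t u for u counted by [defect]. *)
Definition bad_points (F T : {fset G}) : seq (G * (G * 'I_d)) :=
  [seq (s, p) | s <- F, p <- [seq (t, v) | t <- T,
     v <- [seq sigma t u | u in
             [pred u | sigma s (sigma t u) != sigma (s * t)%g u]]]].

Lemma size_bad_points (F T : {fset G}) :
  size (bad_points F T) = (\sum_(s <- F) \sum_(t <- T) defect s t)%N.
Proof.
rewrite size_allpairs_dep sumnE big_map; apply: eq_bigr => s _.
rewrite size_allpairs_dep sumnE big_map; apply: eq_bigr => t _.
by rewrite size_image.
Qed.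

(** The lower bound before passing to the limit: only the relations at bad
    points survive under [pullback], hence the error term. *)
Lemma length_sigma_bar_le (K : realType) (L : lmodType R -> \bar K) m
    (f : 'M[grpring R G]_(m, n)) (A B : submodClosed rM2) (bs : seq rM2)
    (F T : {fset G}) :
  length_function L -> (forall k, row_res f k \in A) ->
  B =i span_mod [set` bs] ->
  (forall b j, b \in bs -> {subset finsupp ((b : M2) 0 j) <= T}) ->
  (L (submod (range_mod (sigma_bar_mx sigma f))) <=
   L (submod (sofic_mod A B F sigma)) +
   (\sum_(s <- F) \sum_(t <- T) defect s t * size bs)%:R%:E * L R^o)%E.
Proof.
move=> lenL rowA Bs bsT.
pose gens := [seq pullback sigma
    (delta_at p.2.2 b - delta_at (sigma p.1 p.2.2) (gr_act p.1 b))
  | p <- bad_points F T, b <- bs].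
have <- : size gens = (\sum_(s <- F) \sum_(t <- T) defect s t * size bs)%N.
  rewrite size_allpairs size_bad_points big_distrl/=.
  by apply: eq_bigr => s _; rewrite big_distrl.
have relN v b s : b \in bs -> s \in F ->
    pullback sigma (delta_at v b - delta_at (sigma s v) (gr_act s b)) \in
    span_mod [set` gens].
  move=> bsb Fs.
  have [|/allPn[t Tt bad]] :=
      boolP (all (fun t => sigma s v == sigma (s * t)%g ((sigma t)^-1%g v)) T).
    move=> /allP good.
    rewrite (@pullback_rel_eq0 _ _ _ _ _ T) ?rpred0// => [j|t Tt].
    - exact: bsT.
    - exact/eqP/good.
  apply: mem_span; apply/allpairsP; exists ((s, (t, v)), b); split => //=.
  apply/allpairsPdep; exists s, (t, v); split => //.
  apply/allpairsPdep; exists t, v; split => //.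
  apply/mapP; exists ((sigma t)^-1%g v); last by rewrite permKV.
  by rewrite mem_enum inE permKV.
have combA x : lin_comb (row_res f) x \in submod_pow A d.
  apply/forallP => v; rewrite ffunE.
  by apply: rpred_sum => k _; apply/rpredZ/rowA.
have h := @length_range_le_sofic_mod R G _ d sigma B F K L _ _ (pullback sigma)
  (sigma_bar_mx sigma f) (lin_comb (row_res f)) A bs gens lenL combA
  (pullback_lin_comb _ _) Bs relN.
exact: h.
Qed.

End Defects.

(** * Vanishing of the error term *)

Lemma complement_cvg (K : realType) (T : Type) (F : set_system T)
    (g h : T -> K) :
  Filter F -> g x @[x --> F] --> (1 : K) ->
  (\forall x \near F, 1 - g x = h x) -> h x @[x --> F] --> (0 : K).
Proof.
move=> FF g1 gh; have gap := cvgB (cvg_cst (1 : K)) g1.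
rewrite subrr in gap.
by move=> A /gap; apply: filterS2 gh => x /= <-.
Qed.

Lemma sum_cvg0 (K : realType) (T I : Type) (F : set_system T) (X : seq I)
    (g : I -> T -> K) :
  Filter F -> (forall i, g i x @[x --> F] --> (0 : K)) ->
  \sum_(i <- X) g i x @[x --> F] --> (0 : K).
Proof.
move=> FF g0; elim: X => [|i X IH].
  under eq_fun do rewrite big_nil.
  exact: cvg_cst.
under eq_fun do rewrite big_cons.
have sum0 := cvgD (g0 i) IH.
rewrite addr0 in sum0.
by move=> A /sum0.
Qed.

Section Limits.
Variables (disp : Order.disp_t) (J : preorderType disp).

Lemma free_ultrafilter_tails (omega : set_system J) :
  free_ultrafilter omega -> @net_tails _ J `<=` omega.
Proof.
move=> [Uo tails] A [j _ jA].
have Fo : ProperFilter omega by exact: ultra_proper.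
exact: filterS jA (tails j).
Qed.

(** The positivity of d i, true along omega since d tends to infinity, is what
    turns the proportion of good points into that of bad points. *)
Lemma defect_cvg (K : realType) (G : groupType) (d : J -> nat)
    (sigma : forall i, G -> 'S_(d i)) (omega : set_system J) s t :
  sofic_approximation K sigma -> free_ultrafilter omega ->
  ((defect (sigma i) s t)%:R / (d i)%:R : K) @[i --> omega] --> (0 : K).
Proof.
move=> sofic free; have sub := free_ultrafilter_tails free.
have Fo : ProperFilter omega by case: free => Uo _; exact: ultra_proper.
have d0 : \forall i \near omega, (0 < d i)%N.
  by apply: sub; have := sofic_dim sofic (nbhs_infty_gt 0%N).
pose good i := [pred v : 'I_(d i) |
  sigma i s (sigma i t v) == sigma i (s * t)%g v].
have good1 : (#|good i|%:R / (d i)%:R : K) @[i --> omega] --> (1 : K).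
  by move=> A /(sofic_mul sofic s t) /sub.
apply: complement_cvg good1 _; apply: filterS d0 => i di.
have di0 : (d i)%:R != 0 :> K by rewrite pnatr_eq0 -lt0n.
apply: (mulIf di0); rewrite mulrBl mul1r !divfK//.
rewrite -[X in X%:R - _](card_ord (d i)).
rewrite -(cardC (good i)).
by rewrite natrD addrAC subrr add0r.
Qed.

Lemma total_defect_cvg (K : realType) (G : groupType) (d : J -> nat)
    (sigma : forall i, G -> 'S_(d i)) (omega : set_system J)
    (F T : {fset G}) (k : nat) (r : K) :
  sofic_approximation K sigma -> free_ultrafilter omega ->
  ((\sum_(s <- F) \sum_(t <- T) defect (sigma i) s t * k)%:R * r / (d i)%:R)%:E
     @[i --> omega] --> (0 : \bar K)%E.
Proof.
move=> sofic free.
have Fo : ProperFilter omega by case: free => Uo _; exact: ultra_proper.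
apply: cvg_EFin; first exact: nearW.
have termwise i :
    (\sum_(s <- F) \sum_(t <- T) defect (sigma i) s t * k)%:R * r / (d i)%:R =
    \sum_(s <- F) \sum_(t <- T)
      (defect (sigma i) s t)%:R / (d i)%:R * (k%:R * r) :> K.
  rewrite natr_sum !mulr_suml; apply: eq_bigr => s _.
  rewrite natr_sum !mulr_suml; apply: eq_bigr => t _.
  by rewrite natrM -!mulrA; congr (_ * _); rewrite mulrA mulrC.
rewrite /comp/=; under eq_fun do rewrite termwise.
apply: sum_cvg0 => s; apply: sum_cvg0 => t.
rewrite -(mul0r (k%:R * r)); apply: cvgM; last exact: cvg_cst.
exact: defect_cvg.
Qed.

End Limits.

(** * The mean length of the submodule generated by the rows of f *)

Section ResPred.
Variables (R : pzRingType) (G : groupType) (M : lmodType (grpring R G)).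

(** An R[G]-submodule viewed as an R-submodule, so that R-spans can be compared
    with it. *)
Definition resscal_submod (N : submodClosed M) : {pred resscal M} := [in N].

Fact resscal_submod_closed N : subsemimod_closed (resscal_submod N).
Proof.
split; first split.
- exact: rpred0.
- by move=> x y Nx Ny; apply: (rpredD (V := M)).
- by move=> a x Nx; apply: (rpredZ (V := M)).
Qed.

HB.instance Definition _ N :=
  GRing.isSubmodClosed.Build R (resscal M) (resscal_submod N)
    (resscal_submod_closed N).
End ResPred.

Theorem proposition6p1 (K : realType) (R : pzRingType)
    (L : lmodType R -> \bar K) (G : groupType)
    (disp : Order.disp_t) (J : preorderType disp) (d : J -> nat)
    (sigma : forall i : J, G -> 'S_(d i)) (omega : set_system J)
    (m n : nat) (f : 'M[grpring R G]_(m, n)) :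
  length_function L -> (L R^o < +oo)%E ->
  directed_set J -> sofic_approximation K sigma -> free_ultrafilter omega ->
  mean_length L (range_mod (mulmxr f : 'rV_m -> 'rV_n)) sigma omega =
  lim ((L (submod (range_mod (sigma_bar_mx (sigma i) f))) * ((d i)%:R^-1)%:E)%E
         @[i --> omega]).
Proof.
move=> lenL finL _ sofic free.
have Uo : UltraFilter omega by case: free.
have Fo : ProperFilter omega by exact: ultra_proper.
apply/eqP; rewrite eq_le; apply/andP; split.
  apply: ub_ereal_sup => _ [A [[s As] AM1] <-].
  (* The coefficients of the generators of A on the rows of f; their supports go
     into F. *)
  have row_solution a : exists h : 'rV[grpring R G]_m, a \in s -> a = h *m f.
    have [sa|_] := boolP (a \in s); last by exists 0.
    have /AM1/asboolP[h _ <-] : a \in A by rewrite As; apply: mem_span.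
    by exists h.
  have [h hE] := choice row_solution.
  pose gens := codom (row_res f) ++ codom (@std_basis R G n).
  pose B : submodClosed _ := span_mod [set` gens].
  pose supports : seq {fset G} :=
    [seq finsupp (f k j) | k <- enum 'I_m, j <- enum 'I_n] ++
    [seq finsupp (h a 0 k) | a <- s, k <- enum 'I_m].
  pose F := (\bigcup_(X <- supports) X)%fset.
  have inF X : X \in supports -> {subset X <= F}.
    by move=> XS; apply/fsubsetP; rewrite /F (big_rem _ XS) fsubsetUl.
  have basisB j : std_basis R G j \in B.
    by apply: mem_span; rewrite /= mem_cat codom_f orbT.
  have rowB k : row_res f k \in B.
    by apply: mem_span; rewrite /= mem_cat codom_f.
  have entryF k j : {subset finsupp (f k j) <= F}.
    apply: inF; rewrite mem_cat; apply/orP; left.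
    by apply/allpairsP; exists (k, j); rewrite !mem_enum.
  have coefF a k : a \in s -> {subset finsupp (h a 0 k) <= F}.
    move=> sa; apply: inF; rewrite mem_cat; apply/orP; right.
    by apply/allpairsP; exists (a, k); rewrite mem_enum.
  apply: ge_ereal_inf; eexists; first by exists B => //; exists gens.
  apply: ge_ereal_inf; eexists; first by exists F.
  apply: le_lim_ereal; [exact: ultra_cvg_ereal|exact: ultra_cvg_ereal|].
  apply: nearW => i; apply: lee_wpmul2r; first by rewrite lee_fin invr_ge0.
  apply: (length_sofic_mod_le (sigma i) basisB rowB entryF lenL As) => a sa.
  by exists (h a) => [k|]; [exact: coefF | exact: hE].
pose A : submodClosed _ := span_mod [set` codom (row_res f)].
apply: le_ereal_sup_tmp; eexists.
  exists A => //; split; first by exists (codom (row_res f)).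
  suff sub : {subset A <=
      resscal_submod (range_mod (mulmxr f : 'rV_m -> 'rV_n))}.
    by move=> x /sub.
  apply: span_sub.
  move=> _ /= /codomP[k ->]; apply/asboolP; exists (delta_mx 0 k) => //=.
  by rewrite /row_res rowE.
apply: le_ereal_inf_tmp => _ [B [bs Bs] <-].
apply: le_ereal_inf_tmp => _ [F _ <-].
pose supports : seq {fset G} :=
  [seq finsupp ((b : 'rV[grpring R G]_n) 0 j) | b <- bs, j <- enum 'I_n].
pose T := (\bigcup_(X <- supports) X)%fset.
have inT b j : b \in bs ->
    {subset finsupp ((b : 'rV[grpring R G]_n) 0 j) <= T}.
  move=> bsb; apply/fsubsetP.
  have XS : finsupp ((b : 'rV[grpring R G]_n) 0 j) \in supports.
    by apply/allpairsP; exists (b, j); rewrite mem_enum.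
  by rewrite /T (big_rem _ XS) fsubsetUl.
have [r LR] : exists r, L R^o = r%:E.
  by exists (fine (L R^o)); rewrite fineK// ge0_fin_numE// length_ge0.
(* Adding the error term does not change the limit of the right-hand side. *)
set u := (X in (_ <= lim (X @ _))%E).
have cu : cvg (u i @[i --> omega]) by exact: ultra_cvg_ereal.
have cc := total_defect_cvg F T (size bs) r sofic free.
have adde0_def := fin_num_adde_defl (lim (u i @[i --> omega]))
  (isT : 0%E \is a fin_num).
have cuc := @cvgeD _ omega Fo _ _ _ _ _ adde0_def cu cc.
rewrite adde0 in cuc.
rewrite -(cvg_lim _ cuc)//.
apply: le_lim_ereal; [exact: ultra_cvg_ereal|exact: ultra_cvg_ereal|].
apply: nearW => i.
rewrite /u EFinM -ge0_muleDl; last 2 first.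
- exact: length_ge0.
- by rewrite lee_fin mulr_ge0// -lee_fin -LR; exact: length_ge0.
apply: lee_wpmul2r; first by rewrite lee_fin invr_ge0.
rewrite EFinM -LR.
apply: length_sigma_bar_le => // k.
by apply: mem_span; apply: codom_f.
Qed.
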